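(* Let $\Sigma$ be a signature and $\varphi,\psi$ quantified strictly positive formulas over $\Sigma$. If $\varphi\leadsto\psi$ is derivable in $\mathsf{QRC_1}$, then for every adequate Kripke model $\mathcal{M}$ in $\Sigma$, every world $w\in W$, and every $w$-assignment $g$: if $\mathcal{M},w\Vdash^g\varphi$ then $\mathcal{M},w\Vdash^g\psi$.
   Context: A signature $\Sigma$ consists of a finite set of constant names, a finite set of predicate names, and an arity for each predicate name. Variables are the natural numbers; a term is a variable or a constant. Formulas: $\top$; $S(t_0,\dots,t_{n-1})$ for $n$-ary $S$; $\varphi\wedge\psi$; $\Diamond\varphi$; $\forall x\,\varphi$. $\mathrm{fv}(\varphi)$ is the set of free variables. $\varphi[x\leftarrow t]$ replaces every free occurrence of variable $x$ by term $t$ (no renaming of bound variables). $t$ is free for $x$ in $\varphi$ if no free occurrence of $x$ in $\varphi$ lies in the scope of a $\forall y$ with $y$ a variable of $t$. $\mathsf{QRC_1}$ derives sequents $\varphi\leadsto\psi$ by: (1) $\varphi\leadsto\top$, $\varphi\leadsto\varphi$; (2) $\varphi\wedge\psi\leadsto\varphi$, $\varphi\wedge\psi\leadsto\psi$; (3) from $\varphi\leadsto\psi$ and $\varphi\leadsto\chi$ infer $\varphi\leadsto\psi\wedge\chi$; (4) from $\varphi\leadsto\psi$ and $\psi\leadsto\chi$ infer $\varphi\leadsto\chi$; (5) from $\varphi\leadsto\psi$ infer $\Diamond\varphi\leadsto\Diamond\psi$; (6) $\Diamond\Diamond\varphi\leadsto\Diamond\varphi$; (7) from $\varphi\leadsto\psi$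 infer $\varphi\leadsto\forall x\,\psi$ if $x\notin\mathrm{fv}(\varphi)$; (8) from $\varphi[x\leftarrow t]\leadsto\psi$ infer $\forall x\,\varphi\leadsto\psi$ if $t$ is free for $x$ in $\varphi$; (9) from $\varphi\leadsto\psi$ infer $\varphi[x\leftarrow t]\leadsto\psi[x\leftarrow t]$ if $t$ is free for $x$ in $\varphi$ and $\psi$; (10) from $\varphi[x\leftarrow c]\leadsto\psi[x\leftarrow c]$ infer $\varphi\leadsto\psi$ if the constant $c$ occurs in neither $\varphi$ nor $\psi$. A Kripke model $\mathcal{M}$ in $\Sigma$ is a tuple $\langle W,R,\{M_w\}_{w\in W},\{\eta_{w,u}\}_{w,u\in W},\{I_w\}_{w\in W},\{J_w\}_{w\in W}\rangle$ where $W$ is a finite set of worlds, $R$ a binary relation on $W$, each $M_w$ a finite set (domain of $w$), $\eta_{w,u}:M_w\to M_u$ a function for every pair $w,u\in W$, $I_w$ assigns to each constant $c$ an element $c^{I_w}\in M_w$, and $J_w$ assigns to each $n$-ary predicate $S$ a set $S^{J_w}\subseteq (M_w)^n$. It is adequate if $R$ is transitive; $wRu$ and $uRv$ imply $\eta_{w,v}(d)=\eta_{u,v}(\eta_{w,u}(d))$ for all $d\in M_w$; each $\eta_{w,w}$ is the identity; and (concordance) $wRu$ implies $c^{I_u}=\eta_{w,u}(c^{I_w})$ for every constant $c$. A $w$-assignment is a function $g$ from variables to $M_w$, extended to terms by $g(c):=c^{I_w}$. For $x$ a variable, $h\approx_x g$ means $h,g$ agree on all variables other than $x$. Satisfaction: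 $\mathcal{M},w\Vdash^g\top$; $\mathcal{M},w\Vdash^g S(t_0,\dots,t_{n-1})$ iff $\langle g(t_0),\dots,g(t_{n-1})\rangle\in S^{J_w}$; $\mathcal{M},w\Vdash^g\varphi\wedge\psi$ iff both conjuncts hold; $\mathcal{M},w\Vdash^g\Diamond\varphi$ iff there is $u\in W$ with $wRu$ and $\mathcal{M},u\Vdash^{\eta_{w,u}\circ g}\varphi$; $\mathcal{M},w\Vdash^g\forall x\,\varphi$ iff $\mathcal{M},w\Vdash^h\varphi$ for every $w$-assignment $h$ with $h\approx_x g$. *)

(* Defs.v *)
From mathcomp Require Import all_boot.

Set Implicit Arguments.
Unset Strict Implicit.
Unset Printing Implicit Defensive.

Record signature := Signature {
  constant : finType;
  predicate : finType;
  arity : predicate -> nat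
}.

Inductive term (Sg : signature) :=
  | Var of nat
  | Const of constant Sg.
Arguments Var {Sg} x.

Inductive formula (Sg : signature) :=
  | Top
  | Pred (P : predicate Sg) of (arity P).-tuple (term Sg)
  | And of formula Sg & formula Sg
  | Dia of formula Sg
  | All of nat & formula Sg.
Arguments Top {Sg}.

Section Syntax.
Variable Sg : signature.
Implicit Types (t s : term Sg) (phi psi : formula Sg) (x y : nat).

Definition term_vars t : seq nat := if t is Var x then [:: x] else [::].

Definition term_consts t : seq (constant Sg) :=
  if t is Const c then [:: c] else [::].

Fixpoint fv phi : seq nat :=
  match phi with
  | Top => [::]
  | Pred P ts => flatten (map term_vars ts)
  | And phi1 phi2 => fv phi1 ++ fv phi2
  | Dia phi1 => fv phi1
  | All x phi1 => [seq y <- fv phi1 | y != x]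
  end.

Fixpoint consts phi : seq (constant Sg) :=
  match phi with
  | Top => [::]
  | Pred P ts => flatten (map term_consts ts)
  | And phi1 phi2 => consts phi1 ++ consts phi2
  | Dia phi1 => consts phi1
  | All _ phi1 => consts phi1
  end.

Definition term_subst x t s : term Sg :=
  if s is Var y then (if y == x then t else s) else s.

(* Not capture-avoiding: bound variables are never renamed. *)
Fixpoint subst x t phi : formula Sg :=
  match phi with
  | Top => Top
  | Pred P ts => Pred (map_tuple (term_subst x t) ts)
  | And phi1 phi2 => And (subst x t phi1) (subst x t phi2)
  | Dia phi1 => Dia (subst x t phi1)
  | All y phi1 => if y == x then phi else All y (subst x t phi1)
  end.

(* Under [All y], the condition is vacuous when [x] has no free occurrence
   left; otherwise every such occurrence is in the scope of that quantifier. *)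
Fixpoint free_for t x phi : bool :=
  match phi with
  | Top | Pred _ _ => true
  | And phi1 phi2 => free_for t x phi1 && free_for t x phi2
  | Dia phi1 => free_for t x phi1
  | All y phi1 =>
      (x \in fv (All y phi1)) ==> (y \notin term_vars t) && free_for t x phi1
  end.

Inductive QRC1 : formula Sg -> formula Sg -> Prop :=
  | QRC1_top phi : QRC1 phi Top
  | QRC1_refl phi : QRC1 phi phi
  | QRC1_andl phi psi : QRC1 (And phi psi) phi
  | QRC1_andr phi psi : QRC1 (And phi psi) psi
  | QRC1_and phi psi chi : QRC1 phi psi -> QRC1 phi chi ->
      QRC1 phi (And psi chi)
  | QRC1_cut phi psi chi : QRC1 phi psi -> QRC1 psi chi -> QRC1 phi chi
  | QRC1_nec phi psi : QRC1 phi psi -> QRC1 (Dia phi) (Dia psi)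
  | QRC1_trans phi : QRC1 (Dia (Dia phi)) (Dia phi)
  | QRC1_allr x phi psi : x \notin fv phi ->
      QRC1 phi psi -> QRC1 phi (All x psi)
  | QRC1_alll x t phi psi : free_for t x phi ->
      QRC1 (subst x t phi) psi -> QRC1 (All x phi) psi
  | QRC1_subst x t phi psi : free_for t x phi -> free_for t x psi ->
      QRC1 phi psi -> QRC1 (subst x t phi) (subst x t psi)
  | QRC1_const x c phi psi : c \notin consts phi -> c \notin consts psi ->
      QRC1 (subst x (Const c) phi) (subst x (Const c) psi) ->
      QRC1 phi psi.

End Syntax.

Record model (Sg : signature) := Model {
  world : finType;
  acc : rel world;
  domain : world -> finType;
  eta : forall w u : world, domain w -> domain u;
  interp_const : forall w : world, constant Sg -> domain w;
  interp_pred : forall (w : world) (P : predicate Sg),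
    {set (arity P).-tuple (domain w)}
}.
Arguments acc {Sg} m.
Arguments eta {Sg m} w u.
Arguments interp_const {Sg m} w c.
Arguments interp_pred {Sg m} w P.

Record adequate (Sg : signature) (M : model Sg) : Prop := Adequate {
  acc_trans : transitive (acc M);
  eta_comp : forall w u v : world M, acc M w u -> acc M u v ->
    forall d : domain w, eta w v d = eta u v (eta w u d);
  eta_id : forall (w : world M) (d : domain w), eta w w d = d;
  concordant : forall w u : world M, acc M w u ->
    forall c : constant Sg, interp_const u c = eta w u (interp_const w c)
}.

Section Semantics.
Variables (Sg : signature) (M : model Sg).

Definition assignment (w : world M) := nat -> domain w.

Definition term_value (w : world M) (g : assignment w) (t : term Sg) :
    domain w :=
  match t with Var x => g x | Const c => interp_const w c end.

Definition eq_except (w : world M) (x : nat) (h g : assignment w) : Prop :=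
  forall y, y != x -> h y = g y.

Fixpoint sat (w : world M) (g : assignment w) (phi : formula Sg) : Prop :=
  match phi with
  | Top => True
  | Pred P ts => map_tuple (term_value g) ts \in interp_pred w P
  | And phi1 phi2 => sat g phi1 /\ sat g phi2
  | Dia phi1 => exists2 u : world M, acc M w u & sat (eta w u \o g) phi1
  | All x phi1 => forall h : assignment w, eq_except x h g -> sat h phi1
  end.

End Semantics.

(* Main.v *)
Require Import Defs.
From mathcomp Require Import all_boot.
From Stdlib Require Import Setoid.

(** Soundness is proved by induction on the derivation. The only delicate rule
is the elimination of a fresh constant [c] in favour of the variable [x]: to
evaluate formulas at [w] under [g], reinterpret [c] as [eta w u (g x)] in every
world [u]. This is concordant only on the cone above [w], so the accessibility
relation is cut down to arrows that start in that cone; satisfaction at [w] of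
formulas without [c] does not notice the change. *)

Set Implicit Arguments.
Unset Strict Implicit.
Unset Printing Implicit Defensive.

(* Replaces [eq_in_map], since terms carry no [eqType] structure. *)
Lemma eq_map_flatten (A B : Type) (C : eqType) (f1 f2 : A -> B) (v : A -> seq C)
    (s : seq A) :
  (forall a, {subset v a <= flatten (map v s)} -> f1 a = f2 a) ->
  map f1 s = map f2 s.
Proof.
elim: s => //= a s IH eqf; rewrite eqf => [|y ya]; last by rewrite mem_cat ya.
rewrite IH // => b sb; apply: eqf => y /sb ys.
by rewrite mem_cat ys orbT.
Qed.

Section Soundness.
Variable Sg : signature.
Implicit Types (phi psi : formula Sg) (t s : term Sg).

Lemma term_subst_id x t s : x \notin term_vars s -> term_subst x t s = s.
Proof. by case: s => [y|//] /=; rewrite inE eq_sym => /negbTE->. Qed.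

Lemma subst_id x t phi : x \notin fv phi -> subst x t phi = phi.
Proof.
elim: phi => [//|P ts|phi1 IH1 phi2 IH2|phi IH|y phi IH] /=.
- move=> xNts; congr Pred; apply: val_inj => /=.
  rewrite -[RHS]map_id; apply: (eq_map_flatten (v := @term_vars Sg)) => s sts.
  by apply: term_subst_id; apply: contraNN xNts => /sts.
- by rewrite mem_cat negb_or => /andP[/IH1-> /IH2->].
- by move=> /IH->.
- by rewrite mem_filter eq_sym; case: eqVneq => //= _ /IH->.
Qed.

Lemma free_for_const c x phi : free_for (Const c) x phi.
Proof. by elim: phi => //= [? -> ? ->|? ? ->] //; rewrite implybT. Qed.

Definition upd (D : Type) (g : nat -> D) x d : nat -> D :=
  fun y => if y == x then d else g y.

Section Model.
Variable M : model Sg.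

Lemma term_value_vars (w : world M) (g h : assignment w) t :
  {in term_vars t, g =1 h} -> term_value g t = term_value h t.
Proof. by case: t => //= y; apply; rewrite inE. Qed.

Lemma sat_fv phi (w : world M) (g h : assignment w) :
  {in fv phi, g =1 h} -> sat g phi <-> sat h phi.
Proof.
elim: phi w g h => [//|P ts|phi1 IH1 phi2 IH2|phi IH|x phi IH] w g h /= gh.
- suff -> : map_tuple (term_value g) ts = map_tuple (term_value h) ts by [].
  apply: val_inj; apply: (eq_map_flatten (v := @term_vars Sg)) => s sts.
  by apply: term_value_vars => y /sts; apply: gh.
- have E1 : sat g phi1 <-> sat h phi1.
    by apply: IH1 => y y1; apply: gh; rewrite mem_cat y1.
  have E2 : sat g phi2 <-> sat h phi2.
    by apply: IH2 => y y2; apply: gh; rewrite mem_cat y2 orbT.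
  by rewrite E1 E2.
- have E u : sat (eta w u \o g) phi <-> sat (eta w u \o h) phi.
    by apply: IH => y yphi /=; rewrite gh.
  by split=> -[u wu /E]; exists u.
(* The hypothesis is symmetric in the two assignments, so one implication suffices. *)
- have step (a b : assignment w) : {in fv (All x phi), a =1 b} ->
      sat a (All x phi) -> sat b (All x phi).
    move=> ab sat_a k kb.
    (* Moving the value of [k] at [x] onto [a] gives an [x]-variant of [a] that agrees with [k] on
       all free variables of [phi]. *)
    apply/(IH _ k (upd a x (k x))).
      move=> y yphi; rewrite /upd; case: eqVneq => [->//|yx].
      by rewrite kb // ab // mem_filter yx.
    by apply: sat_a => y /negbTE yx; rewrite /upd yx.
  by split; apply: step => // y /gh.
Qed.

Lemma sat_ext phi (w : world M) (g h : assignment w) :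
  g =1 h -> sat g phi <-> sat h phi.
Proof. by move=> gh; apply: sat_fv => y _; apply: gh. Qed.

Hypothesis adM : adequate M.

Lemma eta_term_value (w u : world M) (g : assignment w) t :
  acc M w u -> term_value (eta w u \o g) t = eta w u (term_value g t).
Proof. by move=> wu; case: t => //= c; apply: (concordant adM). Qed.

(** Under [Dia], concordance makes the value of [t] commute with [eta]. Under [All y], freeness
    keeps [y] out of [t], so [y]-variants do not change that value. *)
Lemma sat_subst x t phi (w : world M) (g : assignment w) :
  free_for t x phi ->
  sat g (subst x t phi) <-> sat (upd g x (term_value g t)) phi.
Proof.
elim: phi w g => [//|P ts|phi1 IH1 phi2 IH2|phi IH|y phi IH] w g.
- move=> _ /=; set a := map_tuple _ _; set b := map_tuple _ ts.
  suff -> : a = b by [].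
  apply: val_inj => /=; rewrite -map_comp; apply: eq_map => -[y|//] /=.
  by rewrite /upd; case: eqVneq.
- by move=> /= /andP[/IH1-> /IH2->].
- move=> /= frt.
  have E u : acc M w u -> sat (eta w u \o g) (subst x t phi) <->
      sat (eta w u \o upd g x (term_value g t)) phi.
    move=> wu; rewrite IH //; apply: sat_ext => y.
    by rewrite /upd /= eta_term_value //; case: eqVneq.
  by split=> -[u wu /(E u wu)]; exists u.
(* If [x] is not free here, which includes [y = x], freeness says nothing, but the substitution is
   the identity and the update is invisible. *)
- have [xphi|xNphi] := boolP (x \in fv (All y phi)); last first.
    move=> _; rewrite subst_id //; apply: sat_fv => z zphi.
    by rewrite /upd; case: eqVneq xNphi => // <-; rewrite zphi.
  move=> /= /implyP/(_ xphi)/andP[yt frt].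
  move: xphi; rewrite /= mem_filter => /andP[xy _].
  rewrite eq_sym (negbTE xy) /=.
  have val_h (h : assignment w) :
      eq_except y h g -> term_value h t = term_value g t.
    move=> hg; apply: term_value_vars => z zt.
    by apply: hg; apply: contraNneq yt => <-.
  split=> sat_g h hg.
  (* Updating this [k] at [x] with the value of [t] gives back [h]. *)
  + pose k : assignment w := upd g y (h y).
    have kg : eq_except y k g by move=> z /negbTE zy; rewrite /k /upd zy.
    have := sat_g k kg; rewrite IH // val_h //; apply: (proj1 (sat_ext _ _)).
    move=> z; rewrite /k {1}/upd.
    case: eqVneq => [->|zx]; first by rewrite hg // /upd eqxx.
    rewrite /upd; case: eqVneq => [->//|zy].
    by rewrite hg // /upd (negbTE zx).
  + rewrite IH // val_h //; apply: sat_g => z zy.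
    by rewrite /upd hg.
Qed.

End Model.

Section Reinterpretation.
Variables (M : model Sg) (c : Defs.constant Sg) (w0 : world M) (d : domain w0).

Hypothesis adM : adequate M.

Definition in_cone (u : world M) := (u == w0) || acc M w0 u.

(** As [eta] is given for every pair of worlds, [c] has a value even outside the cone. *)
Definition reinterp_const (u : world M) (a : Defs.constant Sg) : domain u :=
  if a == c then eta w0 u d else interp_const u a.

Definition reinterp : model Sg :=
  @Model Sg (world M) (fun u v => in_cone u && acc M u v) (@domain _ M)
    (@eta _ M) reinterp_const (@interp_pred _ M).

Lemma in_cone_acc u v : in_cone u -> acc M u v -> in_cone v.
Proof.
case/orP=> [/eqP->|w0u] uv; apply/orP; right=> //.
exact: (acc_trans adM) uv.
Qed.

Lemma reinterp_adequate : adequate reinterp.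
Proof.
split=> /=.
- move=> v u z /andP[cu uv] /andP[_ vz].
  by rewrite cu (acc_trans adM uv vz).
- by move=> u v z /andP[_ uv] /andP[_ vz] e; apply: (eta_comp adM).
- exact: (eta_id adM).
- move=> u v /andP[cu uv] a; rewrite /reinterp_const.
  case: eqP => _; last exact: (concordant adM).
  (* For [c] itself, concordance along an arrow from [u] is composition of [eta] when [u] is
     strictly reached from [w0], and [eta_id] when [u] is [w0]. *)
  case/orP: cu => [/eqP uw0|w0u]; last exact: (eta_comp adM).
  by subst u; rewrite (eta_id adM).
Qed.

(** The cone is closed under [acc], so no arrow met when evaluating from inside it has been
    removed. *)
Lemma sat_reinterp phi (w : world M) (g : assignment w) :
  in_cone w -> c \notin consts phi ->
  @sat Sg reinterp w g phi <-> sat g phi.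
Proof.
elim: phi w g => [//|P ts|phi1 IH1 phi2 IH2|phi IH|x phi IH] w g cw /=.
- move=> cNts; set a := map_tuple _ _; set b := map_tuple _ ts.
  suff -> : a = b by [].
  apply: val_inj; apply: (eq_map_flatten (v := @term_consts Sg)) => -[//|e] ets.
  rewrite /= /reinterp_const; case: eqP cNts => // <-.
  by rewrite ets ?inE.
- by rewrite mem_cat negb_or => /andP[/IH1-> // /IH2->].
- move=> cphi; split=> -[u].
    case/andP=> _ wu sat_u; exists u => //.
    by apply/IH => //; apply: in_cone_acc wu.
  move=> wu sat_u; exists u; first by rewrite cw.
  by apply/IH => //; apply: in_cone_acc wu.
- by move=> cphi; split=> sat_g h hg; apply/IH => //; apply: sat_g.
Qed.

Lemma sat_reinterp_subst x phi (g : assignment w0) :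
  g x = d -> c \notin consts phi ->
  @sat Sg reinterp w0 g (subst x (Const c) phi) <-> sat g phi.
Proof.
move=> gx cphi; have cw0 : in_cone w0 by rewrite /in_cone eqxx.
rewrite -sat_reinterp //.
(* At [w0] the new value of [c] is [d], which is already [g x], so the update changes nothing. *)
rewrite (sat_subst reinterp_adequate) ?free_for_const //; apply: sat_ext => y.
rewrite /upd /= /reinterp_const eqxx (eta_id adM) -gx.
by case: eqVneq => [->|].
Qed.

End Reinterpretation.
End Soundness.

Theorem theorem4p4 (Sg : signature) (phi psi : formula Sg) :
  QRC1 phi psi ->
  forall M : model Sg, adequate M ->
  forall (w : world M) (g : assignment w), sat g phi -> sat g psi.
Proof.
elim=> {phi psi} [//|//|phi psi|phi psi|phi psi chi _ IH1 _ IH2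
  |phi psi chi _ IH1 _ IH2|phi psi _ IH|phi|x phi psi xphi _ IH
  |x t phi psi frt _ IH|x t phi psi frphi frpsi _ IH
  |x c phi psi cphi cpsi _ IH] M adM w g.
- by case.
- by case.
- by move=> sat_phi; split; [exact: IH1|exact: IH2].
- by move=> /(IH1 _ adM)/(IH2 _ adM).
- by case=> u wu /(IH _ adM); exists u.
- case=> u wu [v uv sat_v]; exists v; first exact: (acc_trans adM) uv.
  by move: sat_v; apply: (proj1 (sat_ext _ _)) => y /=; rewrite (eta_comp adM wu uv).
- move=> sat_g h hg; apply: IH => //; move: sat_g.
  apply: (proj1 (sat_fv _)) => y yphi; rewrite hg //.
  by apply: contraNneq xphi => <-.
(* The universal premise is instantiated at the [x]-variant sending [x] to the value of [t]. *)
- move=> sat_g; apply: IH => //; apply/sat_subst => //; apply: sat_g => y.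
  by rewrite /upd => /negbTE->.
- by move=> /(sat_subst adM _ frphi)/(IH _ adM)/(sat_subst adM _ frpsi).
(* The induction hypothesis covers all adequate models, hence also the one where [c] is
   reinterpreted from [g x]. *)
- move=> /(sat_reinterp_subst adM (erefl (g x)) cphi).
  move=> /(IH _ (reinterp_adequate c (g x) adM)).
  by move=> /(sat_reinterp_subst adM (erefl (g x)) cpsi).
Qed.
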